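(* For any $n\ge1$, $$\sum_{\pi\in\mathfrak{S}_n(2413,3142)}(-1)^{\mathsf{des}\,\pi}=\begin{cases}0,&n\text{ even},\\(-1)^{(n-1)/2}\,r_{(n-1)/2},&n\text{ odd},\end{cases}$$ where $r_m:=|\mathfrak{A}_{2m+1}(2413,3142)|$.
   Context: $\mathfrak{S}_n(2413,3142)$ is the set of permutations of $[n]$ avoiding both classical patterns $2413$ and $3142$; $\mathfrak{A}_m(2413,3142)$ is the subset of $\mathfrak{S}_m(2413,3142)$ of alternating (up-down) permutations $\pi(1)<\pi(2)>\pi(3)<\cdots$. $\mathsf{des}\,\pi=\#\{i\in[n-1]:\pi(i)>\pi(i+1)\}$. *)

(* Defs.v *)
From HB Require Import structures.
From mathcomp Require Import all_boot all_order all_algebra all_fingroup.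
Set Implicit Arguments. Unset Strict Implicit. Unset Printing Implicit Defensive.
Import GRing.Theory Num.Theory.

(* Permutations of [n] are represented as {perm 'I_n} (values 0..n-1).
   Pattern p is given in one-line notation (e.g. [:: 2; 4; 1; 3]).
   s contains p iff there are positions f 0 < f 1 < ... < f (k-1) such that
   s(f a) < s(f b) exactly when p_a < p_b. *)
Definition contains_pat (n : nat) (s : {perm 'I_n}) (p : seq nat) : bool :=
  [exists f : {ffun 'I_(size p) -> 'I_n},
     [forall a : 'I_(size p), forall b : 'I_(size p),
        ((a < b)%N ==> (f a < f b)%N) &&
        (((s (f a) < s (f b))%N) == (nth 0 p a < nth 0 p b)%N)]].

Definition avoids_2413_3142 (n : nat) (s : {perm 'I_n}) : bool :=
  ~~ contains_pat s [:: 2; 4; 1; 3] && ~~ contains_pat s [:: 3; 1; 4; 2].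

Definition pword (n : nat) (s : {perm 'I_n}) : seq nat :=
  [seq val (s i) | i <- enum 'I_n].

Definition des (n : nat) (s : {perm 'I_n}) : nat :=
  count (fun i => nth 0 (pword s) i.+1 < nth 0 (pword s) i)%N (iota 0 n.-1).

(* up-down: s(1) < s(2) > s(3) < ... ; 0-based: ascent at even i, descent at odd i *)
Definition alternating (n : nat) (s : {perm 'I_n}) : bool :=
  all (fun i => if odd i then (nth 0 (pword s) i.+1 < nth 0 (pword s) i)%N
                else (nth 0 (pword s) i < nth 0 (pword s) i.+1)%N)
      (iota 0 n.-1).

Definition r_alt (m : nat) : nat :=
  #|[set s : {perm 'I_(2 * m + 1)} | avoids_2413_3142 s && alternating s]|.

(* Main.v *)
Require Import Defs.
From HB Require Import structures.
From mathcomp Require Import all_boot all_order all_algebra all_fingroup.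
From mathcomp Require Import qpoly ring zify.
Import GRing.Theory Num.Theory.

Set Implicit Arguments.
Unset Strict Implicit.
Unset Printing Implicit Defensive.

(** A separable permutation of size at least 2 is exactly one of a sum or a skew
    sum. Cutting it at the last possible place, into an arbitrary left factor and
    an indecomposable right factor, concatenates the descent words of the factors
    around one letter (ascent for a sum, descent for a skew sum). Hence the
    generating series [a] of [(-1) ^ des], with its parts [p] and [q] for sums and
    skew sums, satisfies [a = x + p + q], [p = a (a - p)], [q = - a (a - q)], so
    [a + a^3 = x (1 - a^2)]. Refining by the first letter and the parity of
    alternating descent words, the signed series [e] of the up-down permutations
    of odd size satisfies the same cubic equation, which has a unique solution
    without constant term; so [a = e]. An up-down permutation of size [2 m + 1]
    has [m] descents, and [e] has no even coefficients. Power series are replaced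
    by polynomials modulo [X^N]. *)

(** * Separable words and their decompositions *)

Lemma subseq_catP (T : eqType) (l u v : seq T) : subseq l (u ++ v) ->
  exists l1 l2, [/\ l = l1 ++ l2, subseq l1 u & subseq l2 v].
Proof.
case/subseqP=> m sm ->; rewrite -(cat_take_drop (size u) m) mask_cat.
  by do 2!eexists; split; [by []|exact: mask_subseq|exact: mask_subseq].
by rewrite size_takel // sm size_cat leq_addr.
Qed.

Lemma subseq_mapP (T1 T2 : eqType) (f : T1 -> T2) l s :
  subseq l (map f s) -> exists2 l', subseq l' s & l = map f l'.
Proof.
case/subseqP=> m _ ->; exists (mask m s); first exact: mask_subseq.
by rewrite map_mask.
Qed.

Lemma neq_nilE (s : seq nat) : (s != [::]) = (0 < size s).
Proof. by case: s. Qed.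

(* Comparing with [dlt true] is [<] and with [dlt false] is [>], so that sums
   and skew sums, and likewise 3142 and 2413, are treated at once. *)
Definition dlt (c : bool) (x y : nat) := if c then x < y else y < x.

Lemma dlt_trans c : transitive (dlt c).
Proof. by case: c => y x z /=; lia. Qed.

Lemma dlt_asym c x y : dlt c x y -> dlt c y x -> False.
Proof. by case: c => /=; lia. Qed.

Lemma dltN c x y : dlt (~~ c) x y = dlt c y x.
Proof. by case: c. Qed.

Lemma dlt_total c x y : x != y -> ~~ dlt c x y -> dlt c y x.
Proof. by case: c => /=; lia. Qed.

Lemma dlt_add2l c k x y : dlt c (k + x) (k + y) = dlt c x y.
Proof. by case: c; rewrite /= ltn_add2l. Qed.

(** The letters stand in the order a, b, d, e; the chain of values b, e, a, d makes this 3142 for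
    [c = true] and 2413 for [c = false]. *)
Definition pat c a b d e := [&& dlt c b e, dlt c e a & dlt c a d].

Definition separable (s : seq nat) : bool :=
  all (fun a => all (fun b => all (fun d => all (fun e =>
    subseq [:: a; b; d; e] s ==> ~~ (pat true a b d e || pat false a b d e))
    s) s) s) s.

Lemma separableP s :
  reflect (forall c a b d e, subseq [:: a; b; d; e] s -> ~~ pat c a b d e)
    (separable s).
Proof.
apply: (iffP idP) => [h c a b d e sub|h].
  have /mem_subseq m := sub.
  move/allP/(_ a): h; rewrite m ?inE ?eqxx // => /(_ isT).
  move/allP/(_ b); rewrite m ?inE ?eqxx ?orbT // => /(_ isT).
  move/allP/(_ d); rewrite m ?inE ?eqxx ?orbT // => /(_ isT).
  move/allP/(_ e); rewrite m ?inE ?eqxx ?orbT // => /(_ isT).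
  by rewrite sub negb_or; case: c => /andP[].
apply/allP=> a _; apply/allP=> b _; apply/allP=> d _; apply/allP=> e _.
by apply/implyP=> sub; rewrite negb_or !h.
Qed.

Lemma separable_subseq t s : subseq t s -> separable s -> separable t.
Proof.
move=> ts /separableP h; apply/separableP=> c a b d e /subseq_trans/(_ ts).
exact: h.
Qed.

Lemma separable_shift k s : separable (map (addn k) s) = separable s.
Proof.
apply/separableP/separableP => h c a b d e.
  move/(map_subseq (addn k))/(h c); by rewrite /pat !dlt_add2l.
case/subseq_mapP => -[|a' [|b' [|d' [|e' [|? ?]]]]] // sub [-> -> -> ->].
by rewrite /pat !dlt_add2l; exact: h.
Qed.

(** Neither 3142 nor 2413 is itself a sum or a skew sum, so an occurrence cannot straddle [u] and
    [v]. *)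
Lemma separable_cat c u v : allrel (dlt c) u v ->
  separable u -> separable v -> separable (u ++ v).
Proof.
move=> /allrelP uv /separableP hu /separableP hv.
apply/separableP=> c' a b d e /subseq_catP[l1 [l2 [E s1 s2]]].
have l12 x y : x \in l1 -> y \in l2 -> dlt c x y.
  by move=> /(mem_subseq s1) xu /(mem_subseq s2); exact: uv.
move: l1 E l12 s1 s2 => [|a1 [|b1 [|d1 [|e1 [|? ?]]]]] //=.
- by move=> <- _ _; exact: hv.
- case=> -> <- h _ _; have := h a1 e; have := h a1 d; rewrite !inE !eqxx !orbT.
  by rewrite /pat; case: (c); case: (c') => /=; lia.
- case=> -> -> <- h _ _; have := h a1 e; have := h b1 e.
  by rewrite !inE !eqxx !orbT /pat; case: (c); case: (c') => /=; lia.
- case=> -> -> -> <- h _ _; have := h a1 e; have := h b1 e.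
  by rewrite !inE !eqxx !orbT /pat; case: (c); case: (c') => /=; lia.
- by case=> -> -> -> -> _ _ + _; exact: hu.
Qed.

(** * Decomposable words and their last cut *)

Definition dec c (s : seq nat) :=
  has (fun i => allrel (dlt c) (take i s) (drop i s)) (iota 1 (size s).-1).

Lemma decP c (s : seq nat) :
  reflect (exists u v, [/\ s = u ++ v, u != [::], v != [::] &
             allrel (dlt c) u v]) (dec c s).
Proof.
apply: (iffP hasP) => [[i]|[u [v [-> un vn uv]]]].
  simpl in i; rewrite mem_iota => hi ai; exists (take i s), (drop i s).
  rewrite cat_take_drop !neq_nilE size_takel ?size_drop; last by lia.
  by split => //; lia.
exists (size u); last by rewrite take_size_cat // drop_size_cat.
by move: un vn; rewrite mem_iota size_cat !neq_nilE; lia.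
Qed.

Lemma dec_shift c k s : dec c (map (addn k) s) = dec c s.
Proof.
rewrite /dec size_map; apply: eq_has => i.
rewrite -map_take -map_drop allrel_mapl allrel_mapr.
by apply: eq_allrel => x y; rewrite dlt_add2l.
Qed.

(** While the right factor is decomposable, cut it again and move its left part into [u]. *)
Lemma dec_last_cut c s : dec c s -> exists u v,
  [/\ s = u ++ v, u != [::], v != [::], allrel (dlt c) u v & ~~ dec c v].
Proof.
move: {2}(size s) (leqnn (size s)) => n; elim: n s => [|n IH] s.
  by rewrite leqn0 size_eq0 => /eqP->.
move=> sn /decP[u [v [sE un vn uv]]].
have [dv|dv] := boolP (dec c v); last by exists u, v.
have [|u' [v' [vE un' vn' uv' dv']]] := IH v _ dv.
  by move: sn un; rewrite sE size_cat neq_nilE; lia.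
exists (u ++ u'), v'; rewrite sE vE catA; split=> //.
  by rewrite neq_nilE size_cat; move: un; rewrite neq_nilE; lia.
by move: uv; rewrite vE allrel_catr allrel_catl => /andP[_ ->].
Qed.

(** Of two different cuts, the later one would cut the right factor of the earlier one. *)
Lemma last_cut_unique c u v u' v' : u ++ v = u' ++ v' ->
  v != [::] -> v' != [::] -> allrel (dlt c) u v -> allrel (dlt c) u' v' ->
  ~~ dec c v -> ~~ dec c v' -> size u = size u'.
Proof.
wlog lt_uu' : u v u' v' / size u < size u'.
  move=> wl; case: (ltngtP (size u) (size u')) => // h E; first exact: wl.
  by move=> *; symmetry; apply: (wl u' v' u v).
move=> E vn vn' uv uv' dv _; case/negP: dv; apply/decP.
have E1 : v = drop (size u) u' ++ v'.
  by rewrite -(drop_size_cat v (erefl (size u))) E drop_cat lt_uu'.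
exists (drop (size u) u'), v'; split=> //.
  by rewrite neq_nilE size_drop subn_gt0.
by move: uv'; rewrite -{1}(cat_take_drop (size u) u') allrel_catl => /andP[].
Qed.

(** The first entry lies in every left factor and the last in every right factor; this makes sums
    and skew sums exclusive. *)
Lemma dec_head_last c s : dec c s -> dlt c (head 0 s) (last 0 s).
Proof.
case/decP=> -[|x u] [[|y v] [-> //= _ _ /allrelP]]; apply.
  by rewrite inE eqxx.
by rewrite last_cat /= mem_last.
Qed.

Lemma dec_excl s : dec true s -> ~~ dec false s.
Proof.
by move=> /dec_head_last h1; apply/negP=> /dec_head_last; exact: dlt_asym h1.
Qed.

Lemma filter_split_or (T : eqType) (p : pred T) (v : seq T) :
  (exists d e, [/\ subseq [:: d; e] v, ~~ p d & p e])
  \/ v = filter p v ++ filter (predC p) v.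
Proof.
elim: v => [|y v IH]; first by right.
have [py|npy] := boolP (p y).
  case: IH => [[d [e [sub pd pe]]]|E]; [left|right].
    exists d, e; split=> //; exact: (subseq_trans sub (subseq_cons v y)).
  by rewrite /= py /= {1}E.
have [/hasP[e ev pe]|/hasPn hv] := boolP (has p v); [left|right].
  by exists y, e; rewrite /= eqxx sub1seq.
rewrite /= (negPf npy) /=; have /eqP-> : filter p v == [::].
  by rewrite -[_ == _]negbK -has_filter; apply/hasPn.
by congr cons; apply/esym/all_filterP/allP.
Qed.

(* Prepend [x] to [s = u ++ v], cut at its last c-cut. If [x] destroys the cut
   without creating the opposite one, some entries of [v] lie on either side of
   [x]; as [v] is c-indecomposable these are not separated by position, and
   together with [x] and an entry of [u] they form the forbidden pattern. *)
Lemma separable_dec s : uniq s -> separable s -> 1 < size s ->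
  exists c, dec c s.
Proof.
elim: s => [|x s IH] // /andP[xs us] sep; rewrite /= ltnS => s0.
have [s1|s1] := leqP (size s) 1.
  case: s s0 s1 xs {IH us sep} => [|y [|]] // _ _; rewrite inE => xy.
  exists (x < y); apply/decP; exists [:: x], [:: y]; split=> //.
  by rewrite allrel_consl /= !andbT /dlt; case: ltngtP xy => // ->; rewrite eqxx.
have [|c dc] := IH us _ s1; first exact: separable_subseq (subseq_cons _ _) sep.
have [u [v [sE un vn uv dv]]] := dec_last_cut dc.
have [xv|/allPn[e0 e0v xe0]] := boolP (all (dlt c x) v).
  exists c; apply/decP; exists (x :: u), v; rewrite sE; split=> //.
  by rewrite allrel_consl xv.
have [xv|/allPn[d0 d0s xd0]] := boolP (all (dlt (~~ c) x) s).
  exists (~~ c); apply/decP; exists [:: x], s; split=> //.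
    by rewrite neq_nilE.
  by rewrite allrel_consl xv.
exfalso.
have neq y : y \in v -> x != y.
  by apply: contraTneq => <-; move: xs; rewrite sE mem_cat negb_or => /andP[].
have {}xe0 : dlt c e0 x by apply: dlt_total (neq _ e0v) _.
have {}xd0 : dlt c x d0.
  rewrite dltN in xd0; apply: dlt_total xd0.
  by apply: contraNneq xs => <-.
(* In [u], [d0] would precede [e0] and hence [x] in the order [dlt c], against its choice. *)
have d0v : d0 \in v.
  move: d0s; rewrite sE mem_cat => /orP[d0u|//].
  have := allrelP uv _ _ d0u e0v => /dlt_trans/(_ xe0)/dlt_asym.
  by case/(_ xd0).
case: (filter_split_or (dlt c ^~ x) v) => [[d [e [sub xd ex]]]|E].
  have /mem_subseq m := sub.
  have xd' : dlt c x d.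
    by apply: dlt_total xd; rewrite eq_sym neq // m // inE eqxx.
  case: u un uv sE => // z u _ uv sE.
  (* The values z, e, x, d form a [dlt c] chain, while the positions are x, z, d, e: this is the
     pattern [pat c]. *)
  move/separableP/(_ c x z d e): sep; rewrite /pat ex xd' andbT /= andbT.
  have -> : dlt c z e.
    by apply: (allrelP uv); rewrite ?inE ?eqxx // m // !inE eqxx orbT.
  rewrite eqxx => /(_ _)/negP; apply=> //.
  rewrite sE /= eqxx; exact: (subseq_trans sub (suffix_subseq _ _)).
(* Otherwise the entries of [v] on the two sides of [x] are separated by position, a c-cut of [v];
   [e0] and [d0] make both parts nonempty. *)
case/negP: dv; apply/decP.
exists (filter (dlt c ^~ x) v), (filter (predC (dlt c ^~ x)) v); split=> //.
- by apply/eqP=> h; have := mem_filter (dlt c ^~ x) e0 v; rewrite h xe0 e0v.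
- apply/eqP=> h; have := mem_filter (predC (dlt c ^~ x)) d0 v.
  rewrite h d0v /= in_nil andbT => /esym/negbFE; exact: dlt_asym.
apply/allrelP=> y z; rewrite !mem_filter /= => /andP[yx _] /andP[zx zv].
by apply: dlt_trans yx _; apply: dlt_total zx; rewrite eq_sym neq.
Qed.

(** * Direct sums ([join true]) and skew sums ([join false]) of separable permutations *)

Definition join c (u v : seq nat) :=
  map (addn (if c then 0 else size v)) u ++
  map (addn (if c then size u else 0)) v.

(* Excluding [n = 0] gives generating series without constant term. *)
Definition seps n : seq (seq nat) :=
  [seq s <- permutations (iota 0 n) | (0 < n) && separable s].

Lemma mem_seps n s :
  (s \in seps n) = [&& 0 < n, separable s & perm_eq s (iota 0 n)].
Proof. by rewrite mem_filter mem_permutations -andbA. Qed.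

Lemma size_seps n s : s \in seps n -> size s = n.
Proof. by rewrite mem_seps => /and3P[_ _ /perm_size->]; rewrite size_iota. Qed.

Lemma uniq_seps n s : s \in seps n -> uniq s.
Proof. by rewrite mem_seps => /and3P[_ _ /perm_uniq->]; rewrite iota_uniq. Qed.

Lemma seps_neq0 n s : s \in seps n -> s != [::].
Proof.
by move=> h; rewrite neq_nilE (size_seps h); move: h; rewrite mem_seps; case: n.
Qed.

Lemma perm_iota_mem n s x : perm_eq s (iota 0 n) -> x \in s -> x < n.
Proof. by move=> /perm_mem-> ; rewrite mem_iota. Qed.

Lemma allrel_join c u v : perm_eq u (iota 0 (size u)) ->
  perm_eq v (iota 0 (size v)) ->
  allrel (dlt c) (map (addn (if c then 0 else size v)) u)
                 (map (addn (if c then size u else 0)) v).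
Proof.
move=> pu pv; apply/allrelP=> _ _ /mapP[x xu ->] /mapP[y yv ->].
have := perm_iota_mem pu xu; have := perm_iota_mem pv yv.
by case: c => /=; lia.
Qed.

Lemma perm_iota_shift k m : perm_eq (map (addn k) (iota 0 m)) (iota k m).
Proof. by rewrite -iotaDl addn0. Qed.

Lemma seps_join c i j u v : u \in seps i -> v \in seps j ->
  join c u v \in seps (i + j).
Proof.
move=> hu hv; move: (hu) (hv); rewrite !mem_seps.
rewrite -(size_seps hu) -(size_seps hv).
move=> /and3P[i0 su pu] /and3P[j0 sv pv].
rewrite addn_gt0 i0 (@separable_cat c) ?separable_shift ?allrel_join //=.
have h k m s : perm_eq s (iota 0 m) -> perm_eq (map (addn k) s) (iota k m).
  by move=> /(perm_map (addn k)) /perm_trans; apply; exact: perm_iota_shift.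
rewrite /join; case: c.
  by rewrite iotaD perm_cat ?h.
by rewrite perm_catC addnC iotaD perm_cat ?h.
Qed.

(** The sorted factors concatenate to a sorted list, which can only be [iota 0 n]. *)
Lemma perm_iota_split u v n : perm_eq (u ++ v) (iota 0 n) -> allrel ltn u v ->
  perm_eq u (iota 0 (size u)) /\ perm_eq v (iota (size u) (size v)).
Proof.
move=> p uv.
have sz : n = size u + size v.
  by rewrite -(size_iota 0 n) -(perm_size p) size_cat.
have E : sort leq u ++ sort leq v = iota 0 n.
  apply: (sorted_eq leq_trans anti_leq).
  - rewrite (sorted_pairwise leq_trans) pairwise_cat.
    rewrite -!(sorted_pairwise leq_trans) !(sort_sorted leq_total) !andbT.
    apply/allrelP=> x y; rewrite !mem_sort => xu yv.
    by apply: ltnW; exact: (allrelP uv).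
  - exact: iota_sorted.
  - by apply: perm_trans p; rewrite perm_cat ?perm_sort.
move/eqP: E; rewrite sz iotaD eqseq_cat ?size_sort ?size_iota //.
case/andP=> /eqP<- /eqP<-.
by rewrite !(perm_sym _ (sort _ _)) !perm_sort.
Qed.

Lemma perm_iota_unshift k m v : perm_eq v (iota k m) ->
  exists2 w, v = map (addn k) w & perm_eq w (iota 0 m).
Proof.
move=> p; exists (map (subn^~ k) v).
  rewrite -map_comp -[LHS]map_id; apply/eq_in_map=> x.
  by rewrite (perm_mem p) mem_iota /=; lia.
apply: perm_trans (perm_map _ p) _; rewrite -[k in iota k]addn0 iotaDl.
rewrite -map_comp (eq_map (g := id)) ?map_id // => x /=; lia.
Qed.

Lemma dec_join c n s : s \in seps n -> dec c s -> exists u v,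
  [/\ u \in seps (size u), v \in seps (n - size u), size u <= n,
      ~~ dec c v & s = join c u v].
Proof.
move=> hs /dec_last_cut[u [v [sE un vn uv dv]]].
have szs : n = size u + size v by rewrite -(size_seps hs) sE size_cat.
move: hs; rewrite mem_seps => /and3P[_ sep p].
have [sepu sepv] : separable u /\ separable v.
  by rewrite sE in sep; split; apply: separable_subseq sep;
    rewrite ?prefix_subseq ?suffix_subseq.
have [su sv] : 0 < size u /\ 0 < size v by rewrite -!neq_nilE.
have [u' [v' [uE vE pu pv]]] : exists u' v',
  [/\ u = map (addn (if c then 0 else size v)) u',
      v = map (addn (if c then size u else 0)) v',
      perm_eq u' (iota 0 (size u)) & perm_eq v' (iota 0 (size v))].
  case: c {dv} uv => /= uv.
    have [pu /perm_iota_unshift[v' vE pv]] : _ /\ _ :=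
      @perm_iota_split u v n (eq_ind s (fun s => perm_eq s _) p _ sE) uv.
    by exists u, v'; split=> //; rewrite -[LHS]map_id; apply: eq_map.
  (* In a skew sum the right factor holds the small values, so the split is applied to [v ++ u]. *)
  have [||pv /perm_iota_unshift[u' uE pu]] := @perm_iota_split v u n.
  - by rewrite perm_catC -sE.
  - by apply/allrelP=> x y xv yu; exact: (allrelP uv).
  by exists u', v; split=> //; rewrite -[LHS]map_id; apply: eq_map.
have szu : size u' = size u by rewrite uE size_map.
have szv : size v' = size v by rewrite vE size_map.
exists u', v'; rewrite szu szs addKn leq_addr.
split=> //; last by rewrite sE /join szu szv -uE -vE.
- by rewrite mem_seps su pu -(separable_shift (if c then 0 else size v)) -uE sepu.
- by rewrite mem_seps sv pv -(separable_shift (if c then size u else 0)) -vE sepv.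
- by rewrite -(dec_shift c (if c then size u else 0)) -vE.
Qed.

(** Indecomposable right factors make each decomposable permutation arise once. The extreme values
    of [i] contribute nothing, since [seps 0] is empty. *)
Definition join_pairs c n : seq (seq nat) :=
  [seq join c p.1 p.2 | i <- iota 0 n.+1,
     p <- [seq (u, v) | u <- seps i, v <- [seq v <- seps (n - i) | ~~ dec c v]]].

Lemma seps_uniq n : uniq (seps n).
Proof. by rewrite filter_uniq ?permutations_uniq. Qed.

(** Both sides exhibit a last cut of the same word, so the factors have equal lengths. *)
Lemma join_inj c i j i' j' u v u' v' :
  u \in seps i -> v \in seps j -> ~~ dec c v ->
  u' \in seps i' -> v' \in seps j' -> ~~ dec c v' ->
  join c u v = join c u' v' -> (u, v) = (u', v').
Proof.
move=> hu hv dv hu' hv' dv' E.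
have al i1 i2 x y : x \in seps i1 -> y \in seps i2 ->
    allrel (dlt c) (map (addn (if c then 0 else size y)) x)
                 (map (addn (if c then size x else 0)) y).
  move=> hx hy; move: (hx) (hy); rewrite !mem_seps -{1}(size_seps hx).
  rewrite -(size_seps hx) -(size_seps hy) => /and3P[_ _ px] /and3P[_ _ py].
  exact: allrel_join.
have nn k (x : seq nat) : x != [::] -> map (addn k) x != [::].
  by rewrite !neq_nilE size_map.
have szu : size u = size u'.
  have := last_cut_unique E (nn _ _ (seps_neq0 hv)) (nn _ _ (seps_neq0 hv'))
    (al _ _ _ _ hu hv) (al _ _ _ _ hu' hv').
  by rewrite !dec_shift !size_map; apply.
have szv : size v = size v'.
  by move/(congr1 size): E; rewrite /join !size_cat !size_map szu => /addnI.
move/eqP: E; rewrite /join szu szv eqseq_cat ?size_map //.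
by case/andP=> /eqP/(inj_map (@addnI _))-> /eqP/(inj_map (@addnI _))->.
Qed.

Lemma perm_dec_join c n :
  perm_eq [seq s <- seps n | dec c s] (join_pairs c n).
Proof.
apply: uniq_perm; first by rewrite filter_uniq ?seps_uniq.
  apply: allpairs_uniq_dep; first exact: iota_uniq.
    move=> i _; apply: allpairs_uniq; first exact: seps_uniq.
      by rewrite filter_uniq ?seps_uniq.
    by move=> [? ?] [? ?] _ _.
  move=> _ _ /allpairsPdep[i [[u v] [_ hp ->]]]
    /allpairsPdep[i' [[u' v'] [_ hp' ->]]] /=.
  case/allpairsP: hp => -[u1 v1] [/= hu + [? ?]]; subst u1 v1.
  rewrite mem_filter => /andP[dv hv].
  case/allpairsP: hp' => -[u1 v1] [/= hu' + [? ?]]; subst u1 v1.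
  rewrite mem_filter => /andP[dv' hv'] E.
  have [? ?] := join_inj hu hv dv hu' hv' dv' E; subst u' v'.
  (* The index is the length of the left factor, so the pair determines it. *)
  by rewrite -(size_seps hu) -(size_seps hu').
move=> s; rewrite mem_filter; apply/andP/allpairsPdep.
  case=> ds hs; have [u [v [hu hv le dv ->]]] := dec_join hs ds.
  exists (size u), (u, v); split=> //; first by rewrite mem_iota.
  by apply/allpairsP; exists (u, v); split; rewrite //= mem_filter dv.
case=> i [p [+ /allpairsP[[u v] [/= hu + pE]] ->]]; rewrite pE.
rewrite mem_iota add0n ltnS mem_filter => /andP[_ le] /andP[dv hv] /=.
have E : n = i + (n - i) by lia.
split; last by rewrite E (seps_join c hu hv).
apply/decP; do 2!eexists; split; first by rewrite /join.
- by rewrite neq_nilE size_map -neq_nilE (seps_neq0 hu).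
- by rewrite neq_nilE size_map -neq_nilE (seps_neq0 hv).
move: (hu) (hv); rewrite !mem_seps.
rewrite -{1 2}(size_seps hu) -{1 2}(size_seps hv) => /and3P[_ _ pu] /and3P[_ _ pv].
exact: allrel_join.
Qed.

(** * Permutations as words *)

Lemma size_pword n (s : {perm 'I_n}) : size (pword s) = n.
Proof. by rewrite size_map size_enum_ord. Qed.

Lemma nth_pword n (s : {perm 'I_n}) (i : 'I_n) : nth 0 (pword s) i = s i.
Proof. by rewrite (nth_map i) ?size_enum_ord // nth_ord_enum. Qed.

Lemma uniq_pword n (s : {perm 'I_n}) : uniq (pword s).
Proof. by rewrite map_inj_uniq ?enum_uniq // => i j /val_inj/perm_inj. Qed.

Lemma pword_inj n : injective (@pword n).
Proof.
move=> s t st; apply/permP=> i; apply: ord_inj.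
by rewrite -!nth_pword st.
Qed.

(** Both lists are duplicate-free of length n!, so one inclusion suffices. *)
Lemma perm_pword n :
  perm_eq [seq pword s | s <- enum {perm 'I_n}] (permutations (iota 0 n)).
Proof.
have U : uniq [seq pword s | s <- enum {perm 'I_n}].
  by rewrite map_inj_uniq ?enum_uniq //; exact: pword_inj.
apply: uniq_perm => //; first exact: permutations_uniq.
apply: (uniq_min_size U _ _).2.
  move=> _ /mapP[s _ ->]; rewrite mem_permutations.
  apply: uniq_perm; rewrite ?uniq_pword ?iota_uniq //.
  apply: (uniq_min_size (uniq_pword s) _ _).2; last first.
    by rewrite size_iota size_pword.
  by move=> _ /mapP[i _ ->]; rewrite mem_iota ltn_ord.
by rewrite size_permutations ?iota_uniq // size_iota size_map -cardE card_Sn.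
Qed.

Lemma sorted_enum_ord n : sorted (fun i j : 'I_n => i < j) (enum 'I_n).
Proof.
have := iota_ltn_sorted 0 n; rewrite -val_enum_ord sorted_map.
by apply: sub_sorted.
Qed.

Lemma subseq_enum_ord n (l : seq 'I_n) :
  subseq l (enum 'I_n) = sorted (fun i j : 'I_n => i < j) l.
Proof.
have tr : transitive (fun i j : 'I_n => i < j) by move=> j i k; exact: ltn_trans.
apply/idP/idP => [sub|sl].
  exact: (subseq_sorted tr sub (sorted_enum_ord n)).
have -> : l = filter (mem l) (enum 'I_n); last exact: filter_subseq.
apply: (irr_sorted_eq tr (fun i => ltnn i)) => //.
  exact: sorted_filter (sorted_enum_ord n).
by move=> i; rewrite mem_filter mem_enum andbT.
Qed.

Lemma contains_patP n (s : {perm 'I_n}) p :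
  reflect (exists2 l : (size p).-tuple 'I_n, subseq l (enum 'I_n) &
             forall a b, (s (tnth l a) < s (tnth l b)) = (nth 0 p a < nth 0 p b))
    (contains_pat s p).
Proof.
have tr : transitive (fun i j : 'I_n => i < j) by move=> j i k; exact: ltn_trans.
apply: (iffP existsP) => [[f /forallP h]|[l sl h]].
  have {}h (a b : 'I_(size p)) : (a < b -> f a < f b) /\
      (s (f a) < s (f b)) = (nth 0 p a < nth 0 p b).
    by have /forallP/(_ b)/andP[/implyP h1 /eqP h2] := h a.
  exists [tuple f i | i < size p]; last by move=> a b; rewrite !tnth_mktuple (h a b).2.
  rewrite subseq_enum_ord (sorted_pairwise tr) pairwise_map.
  rewrite -(sorted_pairwise (leT := fun i j => f i < f j)).
    by apply: sub_sorted (sorted_enum_ord _) => i j; exact: (h i j).1.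
  by move=> j i k; exact: ltn_trans.
exists [ffun i => tnth l i]; apply/forallP=> a; apply/forallP=> b.
rewrite !ffunE h eqxx andbT; apply/implyP=> ab.
have x0 := tnth l a; rewrite subseq_enum_ord in sl; rewrite !(tnth_nth x0).
by apply: (sorted_ltn_nth tr _ sl) => //; rewrite inE size_tuple.
Qed.

Lemma contains_pat4P n (s : {perm 'I_n}) c :
  reflect (exists a b d e, subseq [:: a; b; d; e] (pword s) /\ pat c a b d e)
    (contains_pat s (if c then [:: 3; 1; 4; 2] else [:: 2; 4; 1; 3])).
Proof.
apply: (iffP (contains_patP _ _)).
  have o i (hi : i < 4) : i < size (if c then [:: 3; 1; 4; 2] else [:: 2; 4; 1; 3]).
    by case: c.
  case=> l sl h; pose f i (hi : i < 4) := tnth l (Ordinal (o i hi)).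
  exists (s (f 0 isT) : nat), (s (f 1 isT) : nat),
    (s (f 2 isT) : nat), (s (f 3 isT) : nat); split.
    suff E : [:: f 0 isT; f 1 isT; f 2 isT; f 3 isT] = l :> seq _.
      by move/(map_subseq (fun i => val (s i))): sl; rewrite -E.
    have x0 := f 0 isT.
    apply: (@eq_from_nth _ x0); first by rewrite size_tuple; case: (c).
    by move=> [|[|[|[|i]]]] //= _; rewrite /f !(tnth_nth x0).
  have H i j (hi : i < 4) (hj : j < 4) : (s (f i hi) < s (f j hj)) = _ :=
    h (Ordinal (o i hi)) (Ordinal (o j hj)).
  (* Comparisons along the chain b, e, a, d: the first three serve 3142, the last three 2413. *)
  move: (H 1 3 isT isT) (H 3 0 isT isT) (H 0 2 isT isT) (H 3 1 isT isT)
    (H 0 3 isT isT) (H 2 0 isT isT).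
  move: (f 0 isT) (f 1 isT) (f 2 isT) (f 3 isT) => f0 f1 f2 f3 /=.
  by rewrite /pat /dlt; case: (c) => /=; lia.
case=> a [b [d [e [/subseq_mapP[l sl E] P]]]].
have [f0 [f1 [f2 [f3 lE]]]] : exists f0 f1 f2 f3, l = [:: f0; f1; f2; f3].
  by case: l E {sl} => [|? [|? [|? [|? [|? ?]]]]] //; do 4!eexists.
move: E sl; rewrite lE => -[? ? ? ?] sl; subst a b d e.
case: c P; rewrite /pat /= => P.
  exists [tuple f0; f1; f2; f3] => // -[[|[|[|[|//]]]] ?] [[|[|[|[|//]]]] ?];
    by rewrite !(tnth_nth f0) /=; lia.
exists [tuple f0; f1; f2; f3] => // -[[|[|[|[|//]]]] ?] [[|[|[|[|//]]]] ?];
  by rewrite !(tnth_nth f0) /=; lia.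
Qed.

Lemma avoids_separable n (s : {perm 'I_n}) :
  avoids_2413_3142 s = separable (pword s).
Proof.
apply/andP/separableP => [[h2 h3] c a b d e sub|h].
  by case: c; apply/negP=> P; [case/negP: h3|case/negP: h2];
    [apply/(contains_pat4P s true)|apply/(contains_pat4P s false)];
    exists a, b, d, e.
by split; apply/negP; [move/(contains_pat4P s false)|move/(contains_pat4P s true)];
  move=> [a [b [d [e [/h sub P]]]]]; have := sub _; [move/(_ false)|move/(_ true)];
  rewrite P.
Qed.

(** * Descent words *)

(* The letter [true] is an ascent. *)
Definition dword (s : seq nat) : seq bool :=
  if s is x :: s' then pairmap ltn x s' else [::].

Lemma dword_shift k s : dword (map (addn k) s) = dword s.
Proof.
case: s => //= x s; elim: s x => //= y s IH x.
by rewrite IH ltn_add2l.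
Qed.

Lemma dword_cat u v : u != [::] -> v != [::] ->
  dword (u ++ v) = dword u ++ (last 0 u < head 0 v) :: dword v.
Proof. by case: u => // x u; case: v => // y v _ _; rewrite /= pairmap_cat. Qed.

(** The values of the two factors compare by [dlt c], so the letter at the junction is [c]. *)
Lemma dword_join c i j u v : u \in seps i -> v \in seps j ->
  dword (join c u v) = dword u ++ c :: dword v.
Proof.
move=> hu hv; have := seps_neq0 hu; have := seps_neq0 hv.
rewrite /join => vn un; rewrite dword_cat ?neq_nilE ?size_map -?neq_nilE //.
rewrite !dword_shift; congr (_ ++ _ :: _).
move: (hu) (hv); rewrite !mem_seps -{1 2}(size_seps hu) -{1 2}(size_seps hv).
move=> /and3P[_ _ pu] /and3P[_ _ pv].
have := allrelP (allrel_join c pu pv); set a := map _ u; set b := map _ v.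
have al : last 0 a \in a by rewrite /a; case: (u) un => //= x u' _; exact: mem_last.
have bh : head 0 b \in b by rewrite /b; case: (v) vn => //= x u' _; rewrite inE eqxx.
by move=> /(_ _ _ al bh); case: (c) => /=; lia.
Qed.

Lemma dwordE s :
  dword s = [seq nth 0 s i < nth 0 s i.+1 | i <- iota 0 (size s).-1].
Proof.
case: s => //= x s; apply: (@eq_from_nth _ false) => [|i].
  by rewrite size_pairmap size_map size_iota.
rewrite size_pairmap => hi; rewrite (nth_pairmap 0) // (nth_map 0) ?size_iota //.
by rewrite nth_iota.
Qed.

Lemma size_dword s : size (dword s) = (size s).-1.
Proof. by rewrite dwordE size_map size_iota. Qed.

Fixpoint altw (b : bool) (w : seq bool) : bool :=
  if w is c :: w' then (c == b) && altw (~~ b) w' else true.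

Lemma altw_cat b u v : altw b (u ++ v) = altw b u && altw (b (+) odd (size u)) v.
Proof.
elim: u b => [|c u IH] b /=; first by rewrite addbF.
by rewrite IH addNb addbN andbA.
Qed.

Lemma altw_nth b w :
  altw b w = all (fun i => nth false w i == b (+) odd i) (iota 0 (size w)).
Proof.
elim: w b => //= c w IH b; rewrite addbF IH -[1]addn0 iotaDl all_map.
by congr (_ && _); apply: eq_all => i /=; rewrite addNb addbN.
Qed.

(** Letters are removed in pairs, each containing one descent. *)
Lemma altw_count b w : altw b w -> ~~ odd (size w) ->
  count negb w = (size w)./2.
Proof.
move: {2}(size w) (leqnn (size w)) => n.
elim: n b w => [|n IH] b [|c [|d w]] //= sw /and3P[/eqP-> /eqP-> aw].
rewrite negbK => ow; rewrite (IH b) ?negbK //; first by case: b {aw}.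
  by rewrite ltnS in sw; exact: ltnW.
by rewrite negbK in aw.
Qed.

Local Open Scope ring_scope.

(** * Algebraic consequences of the recurrences *)

Section NilpotentAlgebra.
Variables (R : comNzRingType) (x : R) (N : nat).
Hypothesis xN0 : x ^+ N = 0.

(** With [x] as the variable, this means having no constant term. *)
Definition multiple_of (u : R) := exists v, u = x * v.

Lemma multiple_ofD u v : multiple_of u -> multiple_of v -> multiple_of (u + v).
Proof. by case=> a -> [b ->]; exists (a + b); rewrite mulrDr. Qed.

Lemma multiple_ofMr u v : multiple_of u -> multiple_of (u * v).
Proof. by case=> a ->; exists (a * v); rewrite mulrA. Qed.

Lemma multiple_ofN u : multiple_of u -> multiple_of (- u).
Proof. by case=> a ->; exists (- a); rewrite mulrN. Qed.

(** Iterating f = -u f gives f = (-u)^N f, and u^N = 0 because x^N = 0. *)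
Lemma nilpotent_add1_reg u f : multiple_of u -> (1 + u) * f = 0 -> f = 0.
Proof.
case=> v -> h; have e : f = - (x * v) * f.
  by apply/eqP; rewrite -subr_eq0 mulNr opprK -[X in X + _]mul1r -mulrDl h.
have eN k : f = (- (x * v)) ^+ k * f.
  by elim: k => [|k IH]; rewrite ?mul1r // exprSr -mulrA -e.
by rewrite (eN N) exprNn exprMn xN0 mul0r mulr0 mul0r.
Qed.

Lemma cubic_unique a b : multiple_of a -> multiple_of b ->
  a + a ^+ 3 = x * (1 - a ^+ 2) -> b + b ^+ 3 = x * (1 - b ^+ 2) -> a = b.
Proof.
move=> Ia Ib ha hb; apply/eqP; rewrite -subr_eq0; apply/eqP.
(* The difference of the two equations is (1 + a^2 + ab + b^2 + x(a + b))(a - b). *)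
apply: (@nilpotent_add1_reg (a * a + a * b + b * b + x * (a + b))).
  do 3?[apply: multiple_ofD]; try exact: multiple_ofMr.
  by exists (a + b).
transitivity ((a + a ^+ 3 - x * (1 - a ^+ 2)) - (b + b ^+ 3 - x * (1 - b ^+ 2))).
  by ring.
by rewrite ha hb !subrr.
Qed.

Lemma signed_cubic a p q : a = x + p + q -> p = a * (a - p) ->
  q = - (a * (a - q)) -> a + a ^+ 3 = x * (1 - a ^+ 2).
Proof.
move=> ha hp hq; apply/eqP; rewrite -subr_eq0; apply/eqP.
(* The multipliers clear the denominators in p = a^2/(1 + a) and q = -a^2/(1 - a). *)
transitivity ((1 - a ^+ 2) * (a - (x + p + q)) + (1 - a) * (p - a * (a - p))
  + (1 + a) * (q - - (a * (a - q)))); first by ring.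
by rewrite -ha -hp -hq !subrr !mulr0 !addr0.
Qed.

(* Up to sign, [e b], [o b] count the alternating descent words of even and odd
   length that start with [b], and [ed b c], [od b c] those of the c-decomposable
   permutations among them. *)
Lemma alternating_cubic (e o : bool -> R) (ed od : bool -> bool -> R) :
  (forall b, multiple_of (e b)) -> (forall b, multiple_of (o b)) ->
  (forall b, e b = x + ed b true + ed b false) ->
  (forall b, o b = od b true + od b false) ->
  (forall b, ed b b = (-1) ^+ (~~ b) * (e b * (o (~~ b) - od (~~ b) b))) ->
  (forall b, ed b (~~ b) = (-1) ^+ b * (o b * (e b - ed b (~~ b)))) ->
  (forall b, od b b = (-1) ^+ (~~ b) * (e b * (e (~~ b) - ed (~~ b) b))) ->
  (forall b, od b (~~ b) = (-1) ^+ b * (o b * (o b - od b (~~ b)))) ->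
  e true + e true ^+ 3 = x * (1 - e true ^+ 2).
Proof.
move=> Ie Io he ho h1 h2 h3 h4.
move: (he true) (he false) (ho true) (ho false) (h1 true) (h1 false)
  (h2 true) (h2 false) (h3 true) (h3 false) (h4 true) (h4 false) => /=.
move: (Ie true) (Ie false) (Io true) (Io false).
move: (e true) (e false) (o true) (o false) => E E' O O'.
move: (ed true true) (ed true false) (ed false true) (ed false false) =>
  E1 E2 E1' E2'.
move: (od true true) (od true false) (od false true) (od false false) =>
  O1 O2 O1' O2'.
rewrite !expr0 !expr1 !mulN1r !mul1r.
move=> IE IE' IO IO' hE hE' hO hO' hE1 hE2' hE2 hE1' hO1 hO2' hO2 hO1'.
set y := E * E'.
have Iy : multiple_of y by exact: multiple_ofMr.
(* [k1] and [k2] eliminate the decomposable parts from the equations for [O] and [O'], with the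
   denominators 1 - O and 1 + O' cleared. *)
have k1 : O * (1 + O') - y * (1 - O) = 0.
  transitivity ((1 - O) * (1 + O') * (O - (O1 + O2))
    + (1 - O) * (1 + O') * (O1 - E * (E' - E1'))
    + (1 + O') * (O2 - - (O * (O - O2)))
    - (1 - O) * E * (E1' - O' * (E' - E1'))).
    by rewrite /y; ring.
  by rewrite -hO -hO1 -hO2 -hE1' !subrr !mulr0 !addr0 subr0.
have k2 : O' * (1 - O) + y * (1 + O') = 0.
  transitivity ((1 - O) * (1 + O') * (O' - (O1' + O2'))
    + (1 - O) * (1 + O') * (O2' - - (E' * (E - E2)))
    + (1 - O) * (O1' - (O' * (O' - O1')))
    + (1 + O') * E' * (E2 - - (O * (E - E2)))).
    by rewrite /y; ring.
  by rewrite -hO' -hO1' -hO2' -hE2 !subrr !mulr0 !addr0.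
(* Adding [k1] and [k2] gives (1 + y)(O + O') = 0. *)
have k3 : O' = - O.
  apply/eqP; rewrite -addr_eq0 addrC; apply/eqP.
  apply: (nilpotent_add1_reg Iy); rewrite -[RHS]addr0 -[X in _ = X + _]k1 -k2.
  by ring.
(* With O' = -O, [k1] reads (1 - O)(O - y) = 0. *)
have k4 : O = y.
  apply/eqP; rewrite -subr_eq0; apply/eqP.
  apply: (nilpotent_add1_reg (multiple_ofN IO)); rewrite -k1 k3; ring.
rewrite k3 k4 in hE1 hE1' hE2 hE2' hO1' hO2 *.
(* The same elimination for [E] and [E'], now with O = y and O' = -y. *)
have l1 : E * (1 + y) = x * (1 - y).
  apply/eqP; rewrite -subr_eq0; apply/eqP.
  transitivity ((1 - y) * (E - (x + E1 + E2))
    + (1 - y) * (E1 - E * (- y - O1')) + (E2 - - (y * (E - E2)))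
    - E * (O1' - - y * (- y - O1'))); first by ring.
  by rewrite -hE -hE1 -hE2 -hO1' !subrr !mulr0 !addr0 subr0.
have l2 : E' * (1 + y) = x * (1 - y).
  apply/eqP; rewrite -subr_eq0; apply/eqP.
  transitivity ((1 - y) * (E' - (x + E1' + E2'))
    + (E1' - - y * (E' - E1')) + (1 - y) * (E2' - - (E' * (y - O2)))
    + E' * (O2 - - (y * (y - O2)))); first by ring.
  by rewrite -hE' -hE1' -hE2' -hO2 !subrr !mulr0 !addr0.
(* Both solve the same linear equation, whose coefficient 1 + y can be cancelled; hence y = E^2. *)
have k5 : E' = E.
  apply/eqP; rewrite -subr_eq0; apply/eqP; apply: (nilpotent_add1_reg Iy).
  by rewrite mulrC mulrBl l1 l2 subrr.
move: l1; rewrite /y k5 -expr2 => <-; ring.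
Qed.

End NilpotentAlgebra.

(** * Signed sums and generating series *)

Definition des_sign (w : seq bool) : int := (-1) ^+ count negb w.

Lemma des_sign_cat c u v :
  des_sign (u ++ c :: v) = (-1) ^+ (~~ c) * (des_sign u * des_sign v).
Proof. by rewrite /des_sign count_cat exprD /= exprD mulrCA. Qed.

(** The parity [p] is [true] for odd length. The empty word counts for both values of [b]. *)
Definition alt_sign b p (w : seq bool) : int :=
  (altw b w && (odd (size w) == p))%:R * des_sign w.

(** Alternation forces [odd (size u) = (c != b)] and makes [v] alternate from [~~ c]; the total
    length then fixes the parity of [v]. *)
Lemma alt_sign_cat b p c u v : alt_sign b p (u ++ c :: v) =
  (-1) ^+ (~~ c) * (alt_sign b (c != b) u * alt_sign (~~ c) (~~ p (+) (c != b)) v).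
Proof.
rewrite /alt_sign des_sign_cat altw_cat size_cat oddD /=.
set U := des_sign u; set V := des_sign v.
have -> : [&& altw b u, c == b (+) odd (size u)
             & altw (~~ (b (+) odd (size u))) v]
    && (odd (size u) (+) ~~ odd (size v) == p)
  = (altw b u && (odd (size u) == (c != b)))
    && (altw (~~ c) v && (odd (size v) == ~~ p (+) (c != b))).
  case: (altw b u) => //=; case: (odd (size u)); case: (odd (size v));
    by case: b; case: c; case: p => //=; rewrite ?andbT ?andbF.
by rewrite -mulnb natrM; ring.
Qed.

Definition word_sum (f : seq bool -> int) n := \sum_(s <- seps n) f (dword s).
Definition dec_sum (f : seq bool -> int) c n :=
  \sum_(s <- seps n | dec c s) f (dword s).

(** From size 2 on, a separable permutation is a sum or a skew sum and never both; size 1 leaves the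
    empty descent word. *)
Lemma word_sumE f n : word_sum f n =
  (n == 1%N)%:R * f [::] + dec_sum f true n + dec_sum f false n.
Proof.
case: n => [|[|n]].
- by rewrite /word_sum /dec_sum !big_nil mul0r !addr0.
- by rewrite /word_sum /dec_sum /seps !unlock /= !addr0 mul1r.
rewrite mul0r add0r /word_sum (bigID (dec true)) /=; congr (_ + _).
rewrite /dec_sum big_seq_cond [RHS]big_seq_cond; apply: eq_bigl => s.
have [hs|//] := boolP (s \in seps n.+2); rewrite /=.
have [|d] := boolP (dec true s); first by move/dec_excl/negPf->.
have [||c] := @separable_dec s (uniq_seps hs).
- by move: hs; rewrite mem_seps => /and3P[].
- by rewrite (size_seps hs).
by case: c => // dt; rewrite dt in d.
Qed.

Lemma word_sum0 f : word_sum f 0%N = 0.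
Proof. by rewrite /word_sum big_nil. Qed.

Lemma word_sum_sub_dec f c n :
  word_sum f n - dec_sum f c n = \sum_(s <- seps n | ~~ dec c s) f (dword s).
Proof. by apply/eqP; rewrite subr_eq addrC /word_sum (bigID (dec c)). Qed.

(** Unique decomposition at the last cut turns multiplicativity around the letter [c] into a Cauchy
    product. *)
Lemma dec_sum_conv f g h k c n :
  (forall u v, f (u ++ c :: v) = k * (g u * h v)) ->
  dec_sum f c n =
  k * \sum_(i < n.+1) word_sum g i * (word_sum h (n - i) - dec_sum h c (n - i)).
Proof.
move=> fE; rewrite /dec_sum -big_filter (perm_big _ (perm_dec_join c n)).
rewrite big_allpairs_dep -[iota 0 n.+1]/(index_iota 0 n.+1) big_mkord mulr_sumr.
apply: eq_bigr => i _; rewrite word_sum_sub_dec big_allpairs big_distrl /= mulr_sumr.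
rewrite big_seq [RHS]big_seq; apply: eq_bigr => u hu.
rewrite big_filter mulr_sumr mulr_sumr big_seq_cond [RHS]big_seq_cond.
apply: eq_bigr => v /andP[hv _].
by rewrite (dword_join c hu hv) fE.
Qed.

(** * Generating series as integer polynomials modulo X^N *)

Section GeneratingSeries.
Variable N : nat.
Hypothesis N_gt1 : (1 < N)%N.

Definition gf (a : nat -> int) :=
  @in_qpoly int 'X^N (\poly_(i < N) a i).

Lemma mk_monic_XN : mk_monic 'X^N = 'X^N :> {poly int}.
Proof. by rewrite mk_monic_Xn prednK // (ltnW N_gt1). Qed.

Lemma in_qpoly_Xn0 : @in_qpoly int 'X^N 'X^N = 0.
Proof.
by apply: val_inj; rewrite /= mk_monic_XN (Pdiv.RingMonic.rmodpp (monicXn _ _)).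
Qed.

(** The part from index [N] on is a multiple of X^N, which vanishes. *)
Lemma in_qpoly_eq (p q : {poly int}) : (forall i, (i < N)%N -> p`_i = q`_i) ->
  in_qpoly 'X^N p = in_qpoly 'X^N q.
Proof.
move=> pq; rewrite -(poly_take_drop N p) -(poly_take_drop N q).
rewrite !rmorphD !rmorphM /= in_qpoly_Xn0 !mulr0; congr (in_qpoly _ _ + _).
by apply/polyP=> i; rewrite !coef_take_poly; case: ltnP => // /pq.
Qed.

Lemma gf_inj a b : gf a = gf b -> forall i, (i < N)%N -> a i = b i.
Proof.
move=> /(congr1 val) /=; rewrite !Pdiv.Ring.rmodp_small.
- move=> /polyP ab i hi; move: (ab i).
  by rewrite !coef_poly hi.
all: by rewrite mk_monic_XN size_polyXn ltnS size_poly.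
Qed.

Lemma gf_ext a b : a =1 b -> gf a = gf b.
Proof. by move=> ab; congr in_qpoly; apply: eq_poly => i _; exact: ab. Qed.

Lemma gfD a b : gf (fun n => a n + b n) = gf a + gf b.
Proof.
rewrite -rmorphD /=; apply: in_qpoly_eq => i hi.
by rewrite coefD !coef_poly hi.
Qed.

Lemma gfB a b : gf (fun n => a n - b n) = gf a - gf b.
Proof.
rewrite -rmorphB /=; apply: in_qpoly_eq => i hi.
by rewrite coefB !coef_poly hi.
Qed.

Lemma gf_sign (c : bool) a : gf (fun n => (-1) ^+ c * a n) = (-1) ^+ c * gf a.
Proof.
rewrite -(rmorph_sign (in_qpoly 'X^N)) -rmorphM; apply: in_qpoly_eq => i hi.
by case: c; rewrite ?mulN1r ?mul1r ?coefN !coef_poly hi ?mulN1r ?mul1r.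
Qed.

Lemma gfM (a b : nat -> int) :
  gf (fun n => \sum_(i < n.+1) a i * b (n - i)%N) = gf a * gf b.
Proof.
rewrite -rmorphM /=; apply: in_qpoly_eq => i hi.
rewrite coefM coef_poly hi; apply: eq_bigr => j _.
have hj : (j < N)%N by apply: leq_trans hi; rewrite ltnS -ltnS ltn_ord.
by rewrite !coef_poly hj (leq_ltn_trans (leq_subr _ _) hi).
Qed.

Lemma gf_X : gf (fun n => (n == 1%N)%:R) = in_qpoly 'X^N 'X.
Proof. by apply: in_qpoly_eq => i hi; rewrite coef_poly hi coefX. Qed.

Lemma gf_multiple a : a 0%N = 0 -> multiple_of (in_qpoly 'X^N 'X) (gf a).
Proof.
move=> a0; exists (gf (fun n => a n.+1)); rewrite -rmorphM /=.
apply: in_qpoly_eq => -[|i] hi; rewrite coefXM !coef_poly hi ?a0 //=.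
by rewrite ltnW.
Qed.

Lemma gf_word_sum f : gf (word_sum f) =
  gf (fun n => (n == 1%N)%:R * f [::]) + gf (dec_sum f true) + gf (dec_sum f false).
Proof. by rewrite -!gfD; apply: gf_ext => n; rewrite word_sumE. Qed.

Lemma gf_dec_sum f g h (s c : bool) :
  (forall u v, f (u ++ c :: v) = (-1) ^+ s * (g u * h v)) ->
  gf (dec_sum f c) =
  (-1) ^+ s * (gf (word_sum g) * (gf (word_sum h) - gf (dec_sum h c))).
Proof.
move=> fE; rewrite -gfB -gfM -gf_sign; apply: gf_ext => n.
exact: dec_sum_conv fE.
Qed.

Lemma gf_sign_alt : gf (word_sum des_sign) = gf (word_sum (alt_sign true false)).
Proof.
pose x := @in_qpoly int 'X^N 'X.
have xN : x ^+ N = 0 by rewrite -rmorphXn /= in_qpoly_Xn0.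
have I f : multiple_of x (gf (word_sum f)) by apply: gf_multiple; exact: word_sum0.
apply: (cubic_unique xN (I _) (I _)).
  apply: (@signed_cubic _ x _ (gf (dec_sum des_sign true)) (gf (dec_sum des_sign false))).
  - rewrite gf_word_sum /x -gf_X; congr (_ + _ + _).
    by apply: gf_ext => n; rewrite mulr1.
  - by rewrite [LHS](gf_dec_sum (des_sign_cat true)) mul1r.
  - by rewrite [LHS](gf_dec_sum (des_sign_cat false)) mulN1r.
apply: (alternating_cubic xN (e := fun b => gf (word_sum (alt_sign b false)))
  (o := fun b => gf (word_sum (alt_sign b true)))
  (ed := fun b c => gf (dec_sum (alt_sign b false) c))
  (od := fun b c => gf (dec_sum (alt_sign b true) c))) => // b.
- rewrite gf_word_sum /x -gf_X; congr (_ + _ + _).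
  by apply: gf_ext => n; rewrite /alt_sign /= !mulr1.
(* The size 1 permutation has an empty descent word, of even length, so it is absent from the odd
   series. *)
- rewrite gf_word_sum -[RHS]add0r addrA; congr (_ + _ + _).
  rewrite (@gf_ext _ (fun=> 0)); first
    by rewrite -[gf _]addr0 -(subrr (gf (fun=> 0))) addrA -gfD.
  by move=> n; rewrite /alt_sign mul0r mulr0.
- by rewrite [LHS](gf_dec_sum (alt_sign_cat b false b)) eqxx.
- by rewrite [LHS](gf_dec_sum (alt_sign_cat b false (~~ b))); case: b.
- by rewrite [LHS](gf_dec_sum (alt_sign_cat b true b)) eqxx.
- by rewrite [LHS](gf_dec_sum (alt_sign_cat b true (~~ b))); case: b.
Qed.

End GeneratingSeries.

Lemma word_sum_sign_alt n : word_sum des_sign n = word_sum (alt_sign true false) n.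
(* Truncating at n + 2 keeps the coefficient of index [n] and satisfies 1 < N. *)
Proof. by apply: (gf_inj _ (@gf_sign_alt n.+2 _)). Qed.

(** * Return from descent words to permutations *)

Lemma des_dword n (s : {perm 'I_n}) : des s = count negb (dword (pword s)).
Proof.
rewrite /des dwordE count_map size_pword; apply: eq_in_count => i /=.
rewrite mem_iota => hi; have {hi} hi1 : (i.+1 < n)%N by lia.
(* Adjacent entries are distinct, so a failed ascent is a descent. *)
have := nth_uniq 0%N _ _ (uniq_pword s).
move=> /(_ i i.+1); rewrite !size_pword => /(_ (ltnW hi1) hi1).
by case: ltngtP => //; lia.
Qed.

Lemma alternating_dword n (s : {perm 'I_n}) :
  alternating s = altw true (dword (pword s)).
Proof.
rewrite altw_nth size_dword size_pword /alternating; apply: eq_in_all => i.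
rewrite mem_iota => /= hi; have {hi} hi1 : (i.+1 < n)%N by lia.
rewrite dwordE (nth_map 0%N) ?size_iota ?size_pword ?nth_iota //; try lia.
rewrite add0n; have := nth_uniq 0%N _ _ (uniq_pword s).
move=> /(_ i i.+1); rewrite !size_pword => /(_ (ltnW hi1) hi1) E.
by case: (odd i) => /=; move: E; case: ltngtP => //; lia.
Qed.

Lemma sum_seps (n : nat) (F : seq nat -> int) : (0 < n)%N ->
  \sum_(w <- seps n) F w = \sum_(s : {perm 'I_n} | avoids_2413_3142 s) F (pword s).
Proof.
move=> n0; rewrite /seps big_filter -(perm_big _ (perm_pword n)) big_map big_enum_cond.
by apply: eq_bigl => s; rewrite n0 avoids_separable.
Qed.

Unset Implicit Arguments.

Theorem theorem6p5 (n : nat) (hn : (1 <= n)%N) :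
  \sum_(s : {perm 'I_n} | avoids_2413_3142 s) ((-1) ^+ des s : int) =
  (if odd n then (-1) ^+ ((n - 1) %/ 2) * ((r_alt ((n - 1) %/ 2))%:Z) else 0).
Proof.
transitivity (word_sum des_sign n).
  rewrite /word_sum (sum_seps (fun w => des_sign (dword w))) //.
  by apply: eq_bigr => s _; rewrite des_dword.
rewrite word_sum_sign_alt /word_sum (sum_seps (fun w => alt_sign true false (dword w))) //.
have [on|en] := boolP (odd n); last first.
  (* For even [n] the descent word has odd length, so every term vanishes. *)
  apply: big1 => s _; rewrite /alt_sign size_dword size_pword eqbF_neg.
  have -> : odd n.-1 by lia.
  by rewrite andbF mul0r.
have nE : n = (2 * ((n - 1) %/ 2) + 1)%N by lia.
move: ((n - 1) %/ 2)%N nE hn {on} => m -> _.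
rewrite /r_alt -sum1_card -natz natr_sum mulr_sumr big_mkcond [RHS]big_mkcond.
apply: eq_bigr => s _; rewrite inE alternating_dword.
case: ifP => //= _; rewrite /alt_sign; have [a|_] := boolP (altw _ _); last by rewrite mul0r.
have o : odd (size (dword (pword s))) = false by rewrite size_dword size_pword; lia.
(* An alternating descent word of length 2m has m descents, whence the sign (-1)^m. *)
rewrite o eqxx mul1r mulr1 /des_sign (altw_count a) ?o // size_dword size_pword.
by congr (_ ^+ _); lia.
Qed.
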